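(* Let $\Pi\in\mathbb{R}^{5\times5}$ be symmetric positive definite, $\bar\omega_1,\bar\omega_2,\bar\omega_3>0$, and $L\in\mathbb{R}^{6\times5}$. Let $\mathcal{R}_k^{x}\subset\mathbb{R}^4$ be the stealthy reachable set of the vehicle at time $k$ defined in the context, and let $\zeta(1)=[x(1)^\top\ e(1)^\top]^\top\in\mathbb{R}^{10}$ denote the initial condition of the extended state $\zeta=[x^\top\ e^\top]^\top$ of the closed-loop system. For a given $a\in(0,1)$, suppose that $(P^{\zeta},a_1^*,\ldots,a_5^* )$ is a solution of the convex program $$\min_{P,a_1,\ldots,a_5}\ -\log\det P\quad\text{s.t.}\quad a_1,\ldots,a_5\in(0,1),\ \ a_1+\cdots+a_5\ge a,\ \ P=P^\top>0,\ \ \begin{bmatrix} aP & \mathcal{A}^\top P & \mathbf{0}\\ P\mathcal{A} & P & P\mathcal{B}\\ \mathbf{0} & \mathcal{B}^\top P & W_a\end{bmatrix}\ge 0,$$ with $P\in\mathbb{R}^{10\times10}$, $\mathcal{B}=(\mathcal{B}_1,\ldots,\mathcal{B}_5)\in\mathbb{R}^{10\times19}$, $W_a=\mathrm{diag}[(1-a_1)\tfrac{1}{\bar\omega_1}I_3,(1-a_2)\tfrac1{\bar\omega_2},(1-a_3)\tfrac1{\bar\omega_3}I_5,(1-a_4)\tfrac1{\bar\omega_3}I_5,(1-a_5)\Pi]$, and $\mathcal{A},\mathcal{B}_1,\ldots,\mathcal{B}_5$ as in the context. Put $$\alpha_k^{\zeta}:=a^{k-1}\zeta(1)^\top P^{\zeta}\zeta(1)+\frac{(5-a)(1-a^{k-1})}{1-a}$$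 and partition $$P^{\zeta}=\begin{bmatrix}P_1^\zeta&P_2^\zeta\\(P_2^\zeta)^\top&P_3^\zeta\end{bmatrix},\qquad P_1^\zeta\in\mathbb{R}^{4\times4},\ P_2^\zeta\in\mathbb{R}^{4\times6},\ P_3^\zeta\in\mathbb{R}^{6\times6}.$$ Then, for all $k\in\{1,2,\ldots\}$, $$\mathcal{R}_k^{x}\subseteq\mathcal{E}_k^{x}:=\{x\in\mathbb{R}^4: x^\top P^{x}x\le\alpha_k^{x}\},\qquad P^{x}:=P_1^\zeta-P_2^\zeta(P_3^\zeta)^{-1}(P_2^\zeta)^\top,\quad \alpha_k^{x}:=\alpha_k^{\zeta}.$$
   Context: Platoon data: $h,\tau,T_s>0$ and $k_p,k_d\in\mathbb{R}$. Continuous-time matrices: $$A_c=\begin{bmatrix}0&-1&-h&0\\0&0&1&0\\0&0&-\frac1\tau&\frac1\tau\\ \frac{k_p}{h}&-\frac{k_d}{h}&-k_d&-\frac1h\end{bmatrix},\quad B_c=\begin{bmatrix}0&1&0\\0&0&0\\0&0&0\\ \frac{k_p}{h}&\frac{k_d}{h}&\frac1h\end{bmatrix},\quad \Gamma_c=\begin{bmatrix}0\\0\\0\\ \frac1h\end{bmatrix},$$ $$A_{ce}=\begin{bmatrix}0&0&-h&0&1&0\\0&0&1&0&0&0\\0&0&-\frac1\tau&\frac1\tau&0&0\\ \frac{k_p}{h}&0&-k_d&-\frac1h&\frac{k_d}{h}&0\\0&0&-1&0&0&1\\0&0&0&0&0&-\frac1\tau\end{bmatrix},\quad B_{ce1}=[0\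 0\ 0\ 0\ 0\ \tfrac1\tau]^\top .$$ Discretized matrices: $A=e^{A_cT_s}$, $B=\int_0^{T_s}e^{A_c(T_s-s)}B_c\,ds$, $\Gamma=\int_0^{T_s}e^{A_c(T_s-s)}\Gamma_c\,ds$, $A_e=e^{A_{ce}T_s}$, $B_{e1}=\int_0^{T_s}e^{A_{ce}(T_s-s)}B_{ce1}\,ds$. $C_e=[I_5\ \ \mathbf{0}]\in\mathbb{R}^{5\times 6}$. Put $\bar A:=(I-LC_e)A_e$. It is a standing assumption that $C_eA_eB_{e1}\in\mathbb{R}^{5\times1}$ has full column rank; $M^\dagger:=(C_eA_eB_{e1})^\dagger$ is its Moore–Penrose inverse. Closed-loop system under attack (vehicle state $x\in\mathbb{R}^4$, estimation error $e\in\mathbb{R}^6$, attack $\delta\in\mathbb{R}$, disturbances $\tilde\omega\in\mathbb{R}^3$, $\omega_u\in\mathbb{R}$, $\omega_e\in\mathbb{R}^5$), for $k=1,2,\ldots$: $$x(k+1)=Ax(k)+B\tilde\omega(k)+\Gamma\delta(k),$$ $$e(k+1)=\bar Ae(k)-B_{e1}\omega_u(k)-B_{e1}\delta(k)-L\omega_e(k+1),$$ with residual $r(k+1)=C_eA_ee(k)+\omega_e(k+1)$. An attack sequence $\delta$ is stealthy if the resulting residual satisfies $r(k)^\top\Pi r(k)\le1$ at all times $k$. Stealthy reachable set: $\mathcal{R}_k^{x}$ is the set of all states $x\in\mathbb{R}^4$ reachable at time $k$ by this closed-loop system through all possible initial conditions, all disturbance sequences satisfying $\tilde\omega^\top\tilde\omega\le\bar\omega_1$,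 $\omega_u^\top\omega_u\le\bar\omega_2$, $\omega_e^\top\omega_e\le\bar\omega_3$ at all times, and all stealthy attack sequences $\delta$. Matrices used in the program: $$\mathcal{A}=\begin{bmatrix}A&\Gamma M^\dagger C_eA_e\bar A\\ \mathbf{0}&(I-B_{e1}M^\dagger C_eA_e)\bar A\end{bmatrix},\ \mathcal{B}_1=\begin{bmatrix}B\\ \mathbf{0}\end{bmatrix},\ \mathcal{B}_2=\begin{bmatrix}-\Gamma\\ \mathbf{0}\end{bmatrix},$$ $$\mathcal{B}_3=\begin{bmatrix}-\Gamma M^\dagger C_eA_eL\\ (B_{e1}M^\dagger C_eA_e-I)L\end{bmatrix},\ \mathcal{B}_4=\begin{bmatrix}\Gamma M^\dagger\\ -B_{e1}M^\dagger\end{bmatrix},\ \mathcal{B}_5=\begin{bmatrix}-\Gamma M^\dagger\\ B_{e1}M^\dagger\end{bmatrix}.$$ For symmetric matrices, $>0$ and $\ge0$ mean positive definite and positive semidefinite.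
   Formalization: The reachable set at time k is taken from the given initial condition ζ(1) appearing in α_k, for every ζ(1), not as the union over all initial conditions; that union is all of ℝ⁴ at k = 1, while the ellipsoid is bounded. *)

(* Defs.v *)
From HB Require Import structures.
From mathcomp Require Import all_boot all_order all_algebra.
From mathcomp Require Import all_classical all_reals all_analysis.

Set Implicit Arguments.
Unset Strict Implicit.
Unset Printing Implicit Defensive.

Import Order.TTheory GRing.Theory Num.Theory.
Import numFieldNormedType.Exports.

Local Open Scope classical_set_scope.
Local Open Scope ring_scope.

Definition mx_of_rows (R : nzRingType) (m n : nat) (s : seq (seq R)) :
    'M[R]_(m, n) :=
  \matrix_(i < m, j < n) nth 0 (nth [::] s i) j.

Definition quad (R : nzRingType) (n : nat) (M : 'M[R]_n) (x : 'cV[R]_n) : R :=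
  (x^T *m M *m x) 0 0.

Definition sqnorm (R : nzRingType) (n : nat) (x : 'cV[R]_n) : R :=
  (x^T *m x) 0 0.

Definition posdefmx (R : realType) (n : nat) (M : 'M[R]_n) : Prop :=
  M^T = M /\ forall x : 'cV[R]_n, x != 0 -> 0 < quad M x.

Definition possemidefmx (R : realType) (n : nat) (M : 'M[R]_n) : Prop :=
  M^T = M /\ forall x : 'cV[R]_n, 0 <= quad M x.

Definition expmx (R : realType) (n : nat) (M : 'M[R]_n.+1) : 'M[R]_n.+1 :=
  limn (series (fun k : nat => k`!%:R^-1 *: M ^+ k)).

(* Integral over [0, T] of a matrix-valued function, entry by entry. *)
Definition mxint (R : realType) (m n : nat) (T : R) (F : R -> 'M[R]_(m, n)) :
    'M[R]_(m, n) :=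
  \matrix_(i < m, j < n) \int[lebesgue_measure]_(s in `[0, T]) (F s i j).

Definition penrose (R : realType) (m n : nat) (M : 'M[R]_(m, n))
    (X : 'M[R]_(n, m)) : Prop :=
  [/\ M *m X *m M = M, X *m M *m X = X,
      (M *m X)^T = M *m X & (X *m M)^T = X *m M].

(* Moore-Penrose inverse: the matrix satisfying the four Penrose equations,
   which exists and is unique for every real M; the default value 0 of the
   choice operator is thus never used. *)
Definition mpinv (R : realType) (m n : nat) (M : 'M[R]_(m, n)) :
    'M[R]_(n, m) :=
  xget 0 [set X | penrose M X].

Record platoon (R : realType) := Platoon {
  hw : R;  (* time headway h *)
  tau : R;
  Ts : R;
  kp : R;
  kd : R }.

Definition Ac (R : realType) (p : platoon R) : 'M[R]_4 :=
  mx_of_rows 4 4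
  [:: [:: 0            ; -1              ; - hw p          ; 0            ];
      [:: 0            ; 0               ; 1               ; 0            ];
      [:: 0            ; 0               ; - (tau p)^-1    ; (tau p)^-1   ];
      [:: kp p / hw p  ; - (kd p / hw p) ; - kd p          ; - (hw p)^-1  ]].

Definition Bc (R : realType) (p : platoon R) : 'M[R]_(4, 3) :=
  mx_of_rows 4 3
  [:: [:: 0            ; 1               ; 0               ];
      [:: 0            ; 0               ; 0               ];
      [:: 0            ; 0               ; 0               ];
      [:: kp p / hw p  ; kd p / hw p     ; (hw p)^-1       ]].

Definition Gammac (R : realType) (p : platoon R) : 'cV[R]_4 :=
  mx_of_rows 4 1 [:: [:: 0]; [:: 0]; [:: 0]; [:: (hw p)^-1]].

Definition Ace (R : realType) (p : platoon R) : 'M[R]_6 :=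
  mx_of_rows 6 6
  [:: [:: 0           ; 0 ; - hw p       ; 0           ; 1           ; 0             ];
      [:: 0           ; 0 ; 1            ; 0           ; 0           ; 0             ];
      [:: 0           ; 0 ; - (tau p)^-1 ; (tau p)^-1  ; 0           ; 0             ];
      [:: kp p / hw p ; 0 ; - kd p       ; - (hw p)^-1 ; kd p / hw p ; 0             ];
      [:: 0           ; 0 ; -1           ; 0           ; 0           ; 1             ];
      [:: 0           ; 0 ; 0            ; 0           ; 0           ; - (tau p)^-1  ]].

Definition Bce1 (R : realType) (p : platoon R) : 'cV[R]_6 :=
  mx_of_rows 6 1 [:: [:: 0]; [:: 0]; [:: 0]; [:: 0]; [:: 0]; [:: (tau p)^-1]].

Definition Ad (R : realType) (p : platoon R) : 'M[R]_4 :=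
  expmx (Ts p *: Ac p).

Definition Bd (R : realType) (p : platoon R) : 'M[R]_(4, 3) :=
  mxint (Ts p) (fun s => expmx ((Ts p - s) *: Ac p) *m Bc p).

Definition Gamma (R : realType) (p : platoon R) : 'cV[R]_4 :=
  mxint (Ts p) (fun s => expmx ((Ts p - s) *: Ac p) *m Gammac p).

Definition Ae (R : realType) (p : platoon R) : 'M[R]_6 :=
  expmx (Ts p *: Ace p).

Definition Be1 (R : realType) (p : platoon R) : 'cV[R]_6 :=
  mxint (Ts p) (fun s => expmx ((Ts p - s) *: Ace p) *m Bce1 p).

Definition Ce (R : realType) : 'M[R]_(5, 6) :=
  (row_mx 1%:M 0 : 'M[R]_(5, 5 + 1)).

Definition Abar (R : realType) (p : platoon R) (L : 'M[R]_(6, 5)) : 'M[R]_6 :=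
  (1%:M - L *m Ce R) *m Ae p.

Definition Mdag (R : realType) (p : platoon R) : 'rV[R]_5 :=
  mpinv (Ce R *m Ae p *m Be1 p).

(* Time starts at 1.  The residual is generated by the system from time 2 on;
   the values of the sequences at earlier indices are irrelevant. *)
Definition closed_loop (R : realType) (p : platoon R) (L : 'M[R]_(6, 5))
    (x : nat -> 'cV[R]_4) (e : nat -> 'cV[R]_6) (r : nat -> 'cV[R]_5)
    (delta : nat -> R) (wt : nat -> 'cV[R]_3) (wu : nat -> R)
    (we : nat -> 'cV[R]_5) : Prop :=
  forall k : nat, (1 <= k)%N ->
  [/\ x k.+1 = Ad p *m x k + Bd p *m wt k + delta k *: Gamma p,
      e k.+1 = Abar p L *m e k - wu k *: Be1 p - delta k *: Be1 p
               - L *m we k.+1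
    & r k.+1 = Ce R *m Ae p *m e k + we k.+1].

Definition stealthy (R : realType) (Pi : 'M[R]_5) (r : nat -> 'cV[R]_5) :
    Prop :=
  forall k : nat, (2 <= k)%N -> quad Pi (r k) <= 1.

Definition admissible (R : realType) (wb1 wb2 wb3 : R)
    (wt : nat -> 'cV[R]_3) (wu : nat -> R) (we : nat -> 'cV[R]_5) : Prop :=
  forall k : nat, (1 <= k)%N ->
  [/\ sqnorm (wt k) <= wb1, wu k * wu k <= wb2 & sqnorm (we k) <= wb3].

(* States reachable at time k from the extended initial condition
   zeta1 = (x(1), e(1)). *)
Definition stealthy_reach (R : realType) (p : platoon R) (L : 'M[R]_(6, 5))
    (Pi : 'M[R]_5) (wb1 wb2 wb3 : R) (zeta1 : 'cV[R]_(4 + 6)) (k : nat) :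
    set 'cV[R]_4 :=
  [set xk | exists x e r delta wt wu we,
     [/\ closed_loop p L x e r delta wt wu we,
         admissible wb1 wb2 wb3 wt wu we,
         stealthy Pi r,
         col_mx (x 1%N) (e 1%N) = zeta1
       & x k = xk]].

Definition calA (R : realType) (p : platoon R) (L : 'M[R]_(6, 5)) :
    'M[R]_(4 + 6) :=
  block_mx (Ad p) (Gamma p *m Mdag p *m Ce R *m Ae p *m Abar p L)
           0      ((1%:M - Be1 p *m Mdag p *m Ce R *m Ae p) *m Abar p L).

Definition calB1 (R : realType) (p : platoon R) : 'M[R]_(4 + 6, 3) :=
  col_mx (Bd p) 0.

Definition calB2 (R : realType) (p : platoon R) : 'M[R]_(4 + 6, 1) :=
  col_mx (- Gamma p) 0.

Definition calB3 (R : realType) (p : platoon R) (L : 'M[R]_(6, 5)) :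
    'M[R]_(4 + 6, 5) :=
  col_mx (- (Gamma p *m Mdag p *m Ce R *m Ae p *m L))
         ((Be1 p *m Mdag p *m Ce R *m Ae p - 1%:M) *m L).

Definition calB4 (R : realType) (p : platoon R) : 'M[R]_(4 + 6, 5) :=
  col_mx (Gamma p *m Mdag p) (- (Be1 p *m Mdag p)).

Definition calB5 (R : realType) (p : platoon R) : 'M[R]_(4 + 6, 5) :=
  col_mx (- (Gamma p *m Mdag p)) (Be1 p *m Mdag p).

Definition calB (R : realType) (p : platoon R) (L : 'M[R]_(6, 5)) :
    'M[R]_(4 + 6, 3 + (1 + (5 + (5 + 5)))) :=
  row_mx (calB1 p) (row_mx (calB2 p) (row_mx (calB3 p L)
    (row_mx (calB4 p) (calB5 p)))).

Definition bdiag (R : nzRingType) (m n : nat) (M : 'M[R]_m) (N : 'M[R]_n) :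
    'M[R]_(m + n) :=
  block_mx M 0 0 N.

Definition Wa (R : realType) (Pi : 'M[R]_5) (wb1 wb2 wb3 : R)
    (a1 a2 a3 a4 a5 : R) : 'M[R]_(3 + (1 + (5 + (5 + 5)))) :=
  bdiag ((1 - a1) / wb1)%:M
    (bdiag ((1 - a2) / wb2)%:M
      (bdiag ((1 - a3) / wb3)%:M
        (bdiag ((1 - a4) / wb3)%:M ((1 - a5) *: Pi)))).

Definition lmi (R : realType) (m n : nat) (a : R) (A P : 'M[R]_m)
    (B : 'M[R]_(m, n)) (W : 'M[R]_n) : 'M[R]_(m + (m + n)) :=
  block_mx (a *: P)              (row_mx (A^T *m P) 0)
           (col_mx (P *m A) 0)   (block_mx P (P *m B) (B^T *m P) W).

Definition feasible (R : realType) (p : platoon R) (L : 'M[R]_(6, 5))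
    (Pi : 'M[R]_5) (wb1 wb2 wb3 a : R)
    (P : 'M[R]_(4 + 6)) (a1 a2 a3 a4 a5 : R) : Prop :=
  [/\ [/\ 0 < a1 < 1, 0 < a2 < 1, 0 < a3 < 1, 0 < a4 < 1 & 0 < a5 < 1],
      a <= a1 + a2 + a3 + a4 + a5,
      posdefmx P
    & possemidefmx
        (lmi a (calA p L) P (calB p L) (Wa Pi wb1 wb2 wb3 a1 a2 a3 a4 a5))].

Definition solution (R : realType) (p : platoon R) (L : 'M[R]_(6, 5))
    (Pi : 'M[R]_5) (wb1 wb2 wb3 a : R)
    (P : 'M[R]_(4 + 6)) (a1 a2 a3 a4 a5 : R) : Prop :=
  feasible p L Pi wb1 wb2 wb3 a P a1 a2 a3 a4 a5 /\
  forall (Q : 'M[R]_(4 + 6)) (b1 b2 b3 b4 b5 : R),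
    feasible p L Pi wb1 wb2 wb3 a Q b1 b2 b3 b4 b5 ->
    - ln (\det P) <= - ln (\det Q).

Definition alpha (R : realType) (a : R) (P : 'M[R]_(4 + 6))
    (zeta1 : 'cV[R]_(4 + 6)) (k : nat) : R :=
  a ^+ k.-1 * quad P zeta1 + (5 - a) * (1 - a ^+ k.-1) / (1 - a).

Definition Px (R : realType) (P : 'M[R]_(4 + 6)) : 'M[R]_4 :=
  ulsubmx P - ursubmx P *m invmx (drsubmx P) *m (ursubmx P)^T.

Definition ellipsoid (R : realType) (n : nat) (M : 'M[R]_n) (c : R) :
    set 'cV[R]_n :=
  [set x | quad M x <= c].

(* Main.v *)
(** From two consecutive steps, [r (k+2)] is affine in [delta k] with coefficient
    [- C_e A_e B_e1], which has full column rank: hence [delta k] can be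
    expressed through [e k], the disturbances and the bounded residual
    [r (k+2)].  Substituting makes the extended state follow
    [z (k+1) = calA *m z k + calB *m w k] with every block of [w k] bounded.
    The matrix inequality gives [V (k+1) <= a * V k + (5 - a)] for
    [V := quad P (z k)], and minimizing [quad P (col_mx x e)] over [e] yields the
    Schur complement [Px P]. *)
Require Import Defs.
From mathcomp Require Import all_boot all_order all_algebra.
From mathcomp Require Import all_classical all_reals all_analysis.
From mathcomp Require Import ring lra.

Set Implicit Arguments.
Unset Strict Implicit.
Unset Printing Implicit Defensive.

Import Order.TTheory GRing.Theory Num.Theory.
Local Open Scope classical_set_scope.
Local Open Scope ring_scope.

(** * Moore-Penrose inverse under full column rank *)

Lemma sqnorm_eq0 (R : realType) (n : nat) (x : 'cV[R]_n) :
  sqnorm x = 0 -> x = 0.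
Proof.
rewrite /sqnorm mxE => /eqP; rewrite psumr_eq0; last first.
  by move=> i _; rewrite mxE -expr2 sqr_ge0.
move=> /allP x0; apply/colP => i; rewrite mxE; apply/eqP.
by have := x0 i; rewrite mem_index_enum mxE -expr2 sqrf_eq0 => /(_ isT).
Qed.

(** A row [v] killed by the Gram matrix gives [M *m v^T] squared norm zero; a left inverse of [M]
    then forces [v = 0]. *)
Lemma row_full_gram_unit (R : realType) (m n : nat) (M : 'M[R]_(m, n)) :
  row_full M -> M^T *m M \in unitmx.
Proof.
move=> /row_fullP[B BM1]; rewrite -row_free_unit.
apply: inj_row_free => v vMM0.
have Mv0 : M *m v^T = 0.
  by apply: sqnorm_eq0; rewrite /sqnorm trmx_mul trmxK mulmxA -(mulmxA v) vMM0 mul0mx mxE.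
by apply: trmx_inj; rewrite -[v^T]mul1mx -BM1 -mulmxA Mv0 mulmx0 trmx0.
Qed.

Lemma mpinv_mulmx (R : realType) (m n : nat) (M : 'M[R]_(m, n)) :
  row_full M -> mpinv M *m M = 1%:M.
Proof.
move=> fM; have gramU := row_full_gram_unit fM.
have : penrose M (mpinv M).
  (* The default value of [xget] is excluded by a witness: [invmx (M^T *m M) *m M^T] satisfies the
     Penrose equations. *)
  rewrite /mpinv; case: xgetP => [X _ //|/(_ (invmx (M^T *m M) *m M^T))].
  have XM1 : invmx (M^T *m M) *m M^T *m M = 1%:M by rewrite -mulmxA mulVmx.
  case; split.
  - by rewrite -mulmxA XM1 mulmx1.
  - by rewrite XM1 mul1mx.
  - by rewrite !trmx_mul trmxK trmx_inv trmx_mul trmxK mulmxA.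
  - by rewrite XM1 trmx1.
case=> MXM _ _ _; have /row_fullP[B BM1] := fM.
by rewrite -[LHS]mul1mx -BM1 -!mulmxA (mulmxA M) MXM.
Qed.

(** * Block quadratic forms, Schur complement and matrix inequality *)

Lemma posdefmx_unit (R : realType) (n : nat) (M : 'M[R]_n) :
  posdefmx M -> M \in unitmx.
Proof.
move=> [_ Mpos]; rewrite -row_free_unit; apply: inj_row_free => v vM0.
have [/eqP|/Mpos] := eqVneq v^T 0; first by rewrite trmx_eq0 => /eqP.
by rewrite /quad trmxK vM0 mul0mx mxE ltxx.
Qed.

Lemma quad_block_mx (R : realType) (m n : nat) (A : 'M[R]_m)
    (B : 'M[R]_(m, n)) (C : 'M[R]_(n, m)) (D : 'M[R]_n)
    (u : 'cV[R]_m) (v : 'cV[R]_n) :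
  quad (block_mx A B C D) (col_mx u v) =
  quad A u + (u^T *m B *m v) 0 0 + (v^T *m C *m u) 0 0 + quad D v.
Proof.
rewrite /quad tr_col_mx mul_row_block mul_row_col !mulmxDl !mxE.
ring.
Qed.

Lemma quad_bdiag (R : realType) (m n : nat) (A : 'M[R]_m) (D : 'M[R]_n)
    (u : 'cV[R]_m) (v : 'cV[R]_n) :
  quad (bdiag A D) (col_mx u v) = quad A u + quad D v.
Proof. by rewrite quad_block_mx !mulmx0 !mul0mx !mxE !addr0. Qed.

Lemma quad_scale (R : realType) (n : nat) (c : R) (M : 'M[R]_n) (x : 'cV[R]_n) :
  quad (c *: M) x = c * quad M x.
Proof. by rewrite /quad -scalemxAr -scalemxAl mxE. Qed.

Lemma quad_scalar (R : realType) (n : nat) (c : R) (x : 'cV[R]_n) :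
  quad c%:M x = c * sqnorm x.
Proof. by rewrite /quad /sqnorm mul_mx_scalar -scalemxAl mxE. Qed.

Lemma posdefmx_drsubmx (R : realType) (m n : nat) (P : 'M[R]_(m + n)) :
  posdefmx P -> posdefmx (drsubmx P).
Proof.
move=> [Psym Ppos]; split; first by rewrite trmx_drsub Psym.
move=> v v0; have := Ppos (col_mx 0 v).
rewrite col_mx_eq0 (negbTE v0) andbF -[P in quad P _]submxK quad_block_mx.
rewrite /quad trmx0 !mulmx0 !mul0mx !mxE !add0r.
exact.
Qed.

(* Completing the square in the second component. *)
Lemma schur_quad_le (R : realType) (m n : nat) (P : 'M[R]_(m + n))
    (x : 'cV[R]_m) (e : 'cV[R]_n) : posdefmx P ->
  quad (ulsubmx P - ursubmx P *m invmx (drsubmx P) *m (ursubmx P)^T) x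
    <= quad P (col_mx x e).
Proof.
move=> Pd; have Dd := posdefmx_drsubmx Pd.
have DU := posdefmx_unit Dd.
have dlE : dlsubmx P = (ursubmx P)^T by rewrite trmx_ursub (proj1 Pd).
rewrite -[P in leRHS]submxK quad_block_mx dlE.
set A := ulsubmx P; set B := ursubmx P; set D := drsubmx P in Dd DU *.
have Dsym : D^T = D by case: Dd.
(* [f] is the deviation of [e] from the minimizer [- invmx D *m B^T *m x]. *)
pose f := e + invmx D *m B^T *m x.
have f_ge0 : 0 <= quad D f.
  have [->|/(proj2 Dd)/ltW //] := eqVneq f 0.
  by rewrite /quad mulmx0 mxE.
suff -> : quad A x + (x^T *m B *m e) 0 0 + (e^T *m B^T *m x) 0 0 + quad D e =
    quad (A - B *m invmx D *m B^T) x + quad D f by rewrite lerDl.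
have quadDf : f^T *m D *m f = e^T *m D *m e + e^T *m B^T *m x
    + x^T *m B *m e + x^T *m B *m invmx D *m B^T *m x.
  have fD : f^T *m D = e^T *m D + x^T *m B.
    rewrite /f [X in (X *m D)]linearD /= !trmx_mul trmxK trmx_inv Dsym mulmxDl !mulmxA.
    by rewrite mulmxKV.
  rewrite fD /f mulmxDr !mulmxDl !mulmxA mulmxK // -!addrA.
  by congr (_ + _); rewrite addrCA.
rewrite /quad quadDf mulmxBr mulmxBl !mulmxA !mxE.
ring.
Qed.

(* The test vector [- (A z + B w)] in the middle block realizes the Schur
   complement without inverting [P]. *)
Lemma lmi_quad_le (R : realType) (m n : nat) (a : R) (A P : 'M[R]_m)
    (B : 'M[R]_(m, n)) (W : 'M[R]_n) (z : 'cV[R]_m) (w : 'cV[R]_n) :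
  possemidefmx (lmi a A P B W) ->
  quad P (A *m z + B *m w) <= a * quad P z + quad W w.
Proof.
move=> [_]; set y := A *m z + B *m w => /(_ (col_mx z (col_mx (- y) w))).
rewrite /lmi !quad_block_mx quad_scale mul_mx_row mul_row_col mulmx0 mul0mx addr0.
rewrite tr_col_mx mul_row_col mulmx0 addr0.
(* Expanding the right and then the left factor [y] shows that the cross terms of the test form add
   up to [- 2 * quad P y], of which the middle block gives back one. *)
have yPy : y^T *m P *m y = y^T *m P *m A *m z + y^T *m P *m B *m w.
  by rewrite {2}/y mulmxDr !mulmxA.
have yPy' : y^T *m P *m y = z^T *m A^T *m P *m y + w^T *m B^T *m P *m y.
  by rewrite {1}/y [X in (X *m P *m _)]linearD /= !trmx_mul !mulmxDl.
have /(congr1 (fun M : 'M[R]_1 => M 0 0)) := yPy.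
have /(congr1 (fun M : 'M[R]_1 => M 0 0)) := yPy'.
have yN : (- y)^T = - y^T by apply/matrixP => i j; rewrite !mxE.
rewrite /quad yN !mulNmx !mulmxN !mulmxA opprK => E1 E2.
rewrite !mxE in E1 E2 *.
lra.
Qed.

(** * Elimination of the attack *)

Lemma attack_from_residual (R : realType) (p : platoon R) (L : 'M[R]_(6, 5))
    (x : nat -> 'cV[R]_4) (e : nat -> 'cV[R]_6) (r : nat -> 'cV[R]_5)
    (delta : nat -> R) (wt : nat -> 'cV[R]_3) (wu : nat -> R)
    (we : nat -> 'cV[R]_5) (k : nat) :
  closed_loop p L x e r delta wt wu we ->
  \rank (Ce R *m Ae p *m Be1 p) = 1%N -> (1 <= k)%N ->
  (delta k)%:M = Mdag p *m Ce R *m Ae p *m Abar p L *m e k - (wu k)%:M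
    - Mdag p *m Ce R *m Ae p *m L *m we k.+1
    + Mdag p *m we k.+2 - Mdag p *m r k.+2.
Proof.
move=> loop full_col_rank k1; have [_ eS _] := loop k k1.
(* [delta k] enters [e k.+1], so it first shows up in the residual at index [k.+2]. *)
have [_ _ rS] := loop k.+1 isT.
have MM1 : Mdag p *m Ce R *m Ae p *m Be1 p = 1%:M.
  rewrite -!mulmxA mulmxA -mulmxA (mulmxA (Ce R)).
  by apply: mpinv_mulmx; rewrite /row_full full_col_rank.
rewrite rS eS !mulmxDr !mulmxN !mulmxA.
rewrite -!scalemxAr MM1 !scalemx1.
by apply/matrixP => i j; rewrite !mxE; ring.
Qed.

Lemma extended_state_step (R : realType) (p : platoon R) (L : 'M[R]_(6, 5))
    (x : nat -> 'cV[R]_4) (e : nat -> 'cV[R]_6) (r : nat -> 'cV[R]_5)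
    (delta : nat -> R) (wt : nat -> 'cV[R]_3) (wu : nat -> R)
    (we : nat -> 'cV[R]_5) (k : nat) :
  closed_loop p L x e r delta wt wu we ->
  \rank (Ce R *m Ae p *m Be1 p) = 1%N -> (1 <= k)%N ->
  col_mx (x k.+1) (e k.+1) = calA p L *m col_mx (x k) (e k) + calB p L *m
    col_mx (wt k) (col_mx (wu k)%:M
      (col_mx (we k.+1) (col_mx (we k.+2) (r k.+2)))).
Proof.
move=> loop full_col_rank k1; have [xS eS _] := loop k k1.
have dE := attack_from_residual loop full_col_rank k1.
rewrite /calA /calB /calB1 /calB2 /calB3 /calB4 /calB5.
rewrite mul_block_col !mul_row_col !mul_col_mx !add_col_mx !mul0mx !add0r.
congr col_mx.
(* Scaling by [delta k] is turned into a product with a 1 x 1 matrix, where [dE] can be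
   substituted. *)
- rewrite xS -mul_mx_scalar dE !mulmxDr !mulmxN !mulNmx !mulmxA.
  by apply/matrixP => i j; rewrite !mxE; ring.
(* The [wu k] inside [delta k] cancels the one acting directly on the error, hence the zero lower
   block of [calB2]. *)
- rewrite eS -[delta k *: _]mul_mx_scalar dE -[wu k *: _]mul_mx_scalar.
  rewrite !mulmxDr !mulmxDl !mulmxN !mulNmx !mul1mx !mulmxA.
  by apply/matrixP => i j; rewrite !mxE; ring.
Qed.

(** * Disturbance bound and ellipsoid recursion *)

Lemma Wa_quad_le (R : realType) (Pi : 'M[R]_5) (wb1 wb2 wb3 a1 a2 a3 a4 a5 : R)
    (u1 : 'cV[R]_3) (u2 : R) (u3 u4 u5 : 'cV[R]_5) :
  0 < wb1 -> 0 < wb2 -> 0 < wb3 ->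
  a1 < 1 -> a2 < 1 -> a3 < 1 -> a4 < 1 -> a5 < 1 ->
  sqnorm u1 <= wb1 -> u2 * u2 <= wb2 -> sqnorm u3 <= wb3 ->
  sqnorm u4 <= wb3 -> quad Pi u5 <= 1 ->
  quad (Wa Pi wb1 wb2 wb3 a1 a2 a3 a4 a5)
    (col_mx u1 (col_mx u2%:M (col_mx u3 (col_mx u4 u5))))
  <= 5 - (a1 + a2 + a3 + a4 + a5).
Proof.
move=> wb1_gt0 wb2_gt0 wb3_gt0 a1_lt1 a2_lt1 a3_lt1 a4_lt1 a5_lt1 h1 h2 h3 h4 h5.
(* The weights in [Wa] normalize each block by its bound, so the block with parameter [b]
   contributes at most [1 - b]. *)
have bound (b c t : R) : 0 < c -> b < 1 -> t <= c -> (1 - b) / c * t <= 1 - b.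
  move=> c_gt0 b_lt1 t_le; rewrite -mulrA ler_piMr ?subr_ge0 ?(ltW b_lt1) //.
  by rewrite mulrC ler_pdivrMr ?mul1r.
have sq2 : sqnorm u2%:M = u2 * u2.
  by rewrite /sqnorm tr_scalar_mx -scalar_mxM mxE eqxx mulr1n.
rewrite /Wa !quad_bdiag !quad_scalar quad_scale sq2.
have b1 := bound _ _ _ wb1_gt0 a1_lt1 h1.
have b2 := bound _ _ _ wb2_gt0 a2_lt1 h2.
have b3 := bound _ _ _ wb3_gt0 a3_lt1 h3.
have b4 := bound _ _ _ wb3_gt0 a4_lt1 h4.
have b5 : (1 - a5) * quad Pi u5 <= 1 - a5 by rewrite ler_piMr // subr_ge0 ltW.
lra.
Qed.

Lemma alpha1 (R : realType) (a : R) (P : 'M[R]_(4 + 6)) (z : 'cV[R]_(4 + 6)) :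
  alpha a P z 1 = quad P z.
Proof. by rewrite /alpha expr0 subrr mulr0 mul0r addr0 mul1r. Qed.

(** [alpha] is the closed form, via a geometric sum, of the recursion satisfied by the bound on
    [quad P] along the extended state. *)
Lemma alphaS (R : realType) (a : R) (P : 'M[R]_(4 + 6)) (z : 'cV[R]_(4 + 6))
    (k : nat) : a < 1 -> (1 <= k)%N ->
  alpha a P z k.+1 = a * alpha a P z k + (5 - a).
Proof.
case: k => // k a_lt1 _; rewrite /alpha /= exprS.
by field; rewrite subr_eq0 gt_eqF.
Qed.

Theorem corollary1 (R : realType) (p : platoon R)
  (h_gt0 : 0 < hw p) (tau_gt0 : 0 < tau p) (Ts_gt0 : 0 < Ts p)
  (full_col_rank : \rank (Ce R *m Ae p *m Be1 p) = 1%N)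
  (Pi : 'M[R]_5) (Pi_posdef : posdefmx Pi)
  (wb1 wb2 wb3 : R) (wb1_gt0 : 0 < wb1) (wb2_gt0 : 0 < wb2) (wb3_gt0 : 0 < wb3)
  (L : 'M[R]_(6, 5)) (a : R) (a_itv : 0 < a < 1)
  (P : 'M[R]_(4 + 6)) (a1 a2 a3 a4 a5 : R)
  (P_sol : solution p L Pi wb1 wb2 wb3 a P a1 a2 a3 a4 a5)
  (zeta1 : 'cV[R]_(4 + 6)) :
  forall k : nat, (1 <= k)%N ->
    stealthy_reach p L Pi wb1 wb2 wb3 zeta1 k
      `<=` ellipsoid (Px P) (alpha a P zeta1 k).
Proof.
have [a_gt0 a_lt1] := andP a_itv.
have [[[/andP[_ a1_lt1] /andP[_ a2_lt1] /andP[_ a3_lt1] /andP[_ a4_lt1]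
  /andP[_ a5_lt1]] a_le P_pd lmi_psd] _] := P_sol.
move=> k k1 _ [x [e [r [delta [wt [wu [we [loop adm st z1 <-]]]]]]]].
(* Passing to the full form [quad P] first lets the induction run on the extended state. *)
apply: (le_trans (schur_quad_le _ (e k) P_pd)).
elim: k k1 => // -[|k] IH _; first by rewrite z1 alpha1.
have [wt_le wu_le _] := adm k.+1 isT.
(* The step from [k.+1] involves the measurement noise at the next two times, as the attack is read
   off the residual at [k.+3]. *)
have [_ _ we_le] := adm k.+2 isT.
have [_ _ we_le'] := adm k.+3 isT.
rewrite (extended_state_step loop full_col_rank) // alphaS //.
apply: (le_trans (lmi_quad_le _ _ lmi_psd)).
apply: lerD; first by rewrite ler_pM2l // IH.
have := Wa_quad_le wb1_gt0 wb2_gt0 wb3_gt0 a1_lt1 a2_lt1 a3_lt1 a4_lt1 a5_lt1 wt_le wu_le we_le we_le' (st k.+3 isT).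
(* The constraint [a_le] turns [5 - (a1 + ... + a5)] into [5 - a]. *)
by move=> /le_trans; apply; lra.
Qed.
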